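(* Let $n\ge 2$, $m\ge 0$ be integers and let $\underline{Y}=(Y_1,\dots,Y_n)$, $\underline{X}=(X_1,\dots,X_m)$ be $n+m$ indeterminates over $\mathbb{F}_q$. Then the following equality holds in the polynomial ring $\mathbb{F}_q[\underline{Y},\underline{X}]$: $$\Delta_n\big(\Delta_{n-1+m}(\underline{\hat Y_1},\underline{X}),\dots,(-1)^{i+1}\Delta_{n-1+m}(\underline{\hat Y_i},\underline{X}),\dots,(-1)^{n+1}\Delta_{n-1+m}(\underline{\hat Y_n},\underline{X})\big)=\Delta_m(\underline{X})^{q^{n-1}}\,\Delta_{n+m}(\underline{Y},\underline{X})^{1+q+\cdots+q^{n-2}},$$ which is also $$\Delta_n\Big(\frac{\Delta_{n-1+m}(\underline{\hat Y_1},\underline{X})}{\Delta_m(\underline{X})},\dots,\frac{\Delta_{n-1+m}(\underline{\hat Y_i},\underline{X})}{\Delta_m(\underline{X})},\dots,\frac{\Delta_{n-1+m}(\underline{\hat Y_n},\underline{X})}{\Delta_m(\underline{X})}\Big)=(-1)^{\lfloor n/2\rfloor}\Big(\frac{\Delta_{n+m}(\underline{Y},\underline{X})}{\Delta_m(\underline{X})}\Big)^{1+q+\cdots+q^{n-2}},$$ where $\lfloor n/2\rfloor$ is the integer part of $n/2$.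
   Context: $q=p^s$ is a power of a prime $p$. For a commutative ring $A$ containing $\mathbb{F}_q$ and $\underline a=(a_1,\dots,a_n)\in A^n$ with $n\ge 1$, the Moore determinant is $\Delta_n(\underline a):=\det\big(a_j^{q^{i-1}}\big)_{1\le i,j\le n}$ (row $i$, column $j$). For $m=0$ the tuple $\underline{X}$ is empty and $\Delta_0:=1$. For $1\le i\le n$, $\underline{\hat Y_i}:=(Y_1,\dots,Y_{i-1},Y_{i+1},\dots,Y_n)$, and $(\underline{\hat Y_i},\underline X)$, $(\underline Y,\underline X)$ denote concatenated tuples. By Moore's product identity $\Delta_n(\underline a)=\prod_{i=1}^n\prod_{(\epsilon_1,\dots,\epsilon_{i-1})\in\mathbb{F}_q^{i-1}}(a_i+\epsilon_{i-1}a_{i-1}+\cdots+\epsilon_1a_1)$, $\Delta_m(\underline X)$ divides $\Delta_{n-1+m}(\underline{\hat Y_i},\underline X)$ and $\Delta_{n+m}(\underline Y,\underline X)$ in the polynomial ring, so the quotients are polynomials. *)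

(* Defs.v *)
From HB Require Import structures.
From mathcomp Require Export all_boot all_order all_algebra.
From mathcomp Require Export mpoly.

Set Implicit Arguments.
Unset Strict Implicit.
Unset Printing Implicit Defensive.

Import GRing.Theory.
Local Open Scope ring_scope.

(* Tuples are row vectors, so that concatenation of tuples is [row_mx] and
   omission of the i-th entry is [col' i].  Indices start at 0, hence the
   exponent [q ^ i].  For n = 0 the determinant is that of the empty matrix,
   namely 1. *)
Definition Moore (A : comNzRingType) (q n : nat) (a : 'rV[A]_n) : A :=
  \det (\matrix_(i < n, j < n) a 0 j ^+ (q ^ i)).

Definition varY (R : comNzRingType) (n m : nat) : 'rV[{mpoly R[n + m]}]_n :=
  \row_(i < n) 'X_(lshift m i).

Definition varX (R : comNzRingType) (n m : nat) : 'rV[{mpoly R[n + m]}]_m :=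
  \row_(j < m) 'X_(rshift n j).

(* [c] is the quotient a / b, computed inside the integral domain A; it is
   unique when it exists.  The ring operation [a / b] is not usable here, since
   [b^-1] is a junk value when b is not a unit of A. *)
Definition is_quotient (A : idomainType) (a b c : A) : Prop :=
  b != 0 /\ a = c * b.

(* Main.v *)
From HB Require Import structures.
Require Import Defs.
From mathcomp Require Import all_boot all_order all_algebra all_field.
From mathcomp Require Import perm fraction mpoly.
Set Implicit Arguments.
Unset Strict Implicit.
Unset Printing Implicit Defensive.
Import GRing.Theory.
Local Open Scope ring_scope.

(* Write Z = (Y, X), N = n + m, and let W be the matrix whose rows are the
   powers of Z of exponents q^(N-1), 1, q, ..., q^(N-2).  The signed Moore
   minors c_i of Z are the cofactors of the first row of W, so that
   sum_i c_i Z_i^(q^l) is 0 for l < N - 1 and det W for l = N - 1, while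
   sum_i c_i^q Z_i is the Moore determinant of Z.  Let B have the rows
   c^(q^k), k < n, followed by the rows (0 | I_m).  Its determinant is the
   left-hand side of the first identity, and B W^T is block lower triangular:
   the diagonal is det W, Moore(Z)^(q^k) for k < n - 1, and a block of
   determinant Moore(X)^(q^(n-1)).  Cancelling det W gives the identity.
   The quotients exist by Moore's product identity, and the second identity
   follows from the first by scaling rows and columns. *)

(** * Frobenius powers as ring morphisms *)

Definition powp (A : comNzRingType) (r : nat) of [char A].-nat r :=
  fun x : A => x ^+ r.

Lemma powp_zmod_morphism (A : comNzRingType) (r : nat) (hr : [char A].-nat r) :
  zmod_morphism (powp hr).
Proof.
by move=> x y; rewrite /powp exprDn_pchar // exprNn_pchar.
Qed.

Lemma powp_monoid_morphism (A : comNzRingType) (r : nat) (hr : [char A].-nat r) :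
  monoid_morphism (powp hr).
Proof. by split=> [|x y]; rewrite /powp ?expr1n ?exprMn. Qed.

HB.instance Definition _ (A : comNzRingType) (r : nat) (hr : [char A].-nat r) :=
  GRing.isZmodMorphism.Build A A (powp hr) (powp_zmod_morphism hr).
HB.instance Definition _ (A : comNzRingType) (r : nat) (hr : [char A].-nat r) :=
  GRing.isMonoidMorphism.Build A A (powp hr) (powp_monoid_morphism hr).

Lemma pchar_natX (A : comNzRingType) (r k : nat) :
  [char A].-nat r -> [char A].-nat (r ^ k)%N.
Proof. by move=> hr; rewrite pnatX hr. Qed.

Lemma sum_expr_pchar (A : comNzRingType) (r : nat) (I : finType) (f : I -> A) :
  [char A].-nat r -> (\sum_i f i) ^+ r = \sum_i f i ^+ r.
Proof. by move=> hr; apply: (rmorph_sum (powp hr)). Qed.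

Lemma det_expr_pchar (A : comNzRingType) (r k : nat) (M : 'M[A]_k) :
  [char A].-nat r -> \det M ^+ r = \det (\matrix_(i, j) M i j ^+ r).
Proof.
move=> hr; have -> : \matrix_(i, j) M i j ^+ r = map_mx (powp hr) M.
  by apply/matrixP=> i j; rewrite !mxE.
by rewrite det_map_mx.
Qed.

(** Additivity of the power map gives $(-1)^r = -1$ for even [r] too, since then $1 = -1$ in [A]. *)
Lemma sign_expr_pchar (A : comNzRingType) (r i : nat) :
  [char A].-nat r -> ((-1 : A) ^+ i) ^+ r = (-1) ^+ i.
Proof. by move=> hr; rewrite exprAC exprNn_pchar // expr1n. Qed.

(** * Nonvanishing of determinants of powers of indeterminates *)

Lemma expn_injective (q : nat) : (1 < q)%N -> injective (expn q).
Proof. by move=> q1 i j /eqP; rewrite eqn_exp2l // => /eqP. Qed.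

(* The permutations in the Leibniz formula contribute pairwise distinct
   monomials, so the coefficient of the diagonal one is 1. *)
Lemma det_var_expr_neq0 (R : comNzRingType) (N k : nat) (g : 'I_k -> 'I_N)
    (e : 'I_k -> nat) : injective g -> injective e ->
  \det (\matrix_(i < k, j < k) ('X_(g j) : {mpoly R[N]}) ^+ e i) != 0.
Proof.
move=> g_inj e_inj.
pose mu (s : {perm 'I_k}) : 'X_{1..N} :=
  (\sum_(i < k) (U_(g (s i)) *+ e i))%MM.
have muE (s : {perm 'I_k}) j : mu s (g (s j)) = e j.
  rewrite /mu mnm_sumE (bigD1 j) //= mulmnE mnm1E eqxx mul1n big1 ?addn0 //.
  move=> i ij; rewrite mulmnE mnm1E (inj_eq g_inj) (inj_eq perm_inj).
  by rewrite (negPf ij).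
have prodE (s : {perm 'I_k}) : \prod_i (\matrix_(i < k, j < k) ('X_(g j) : {mpoly R[N]}) ^+ e i)
    i (s i) = 'X_[mu s].
  by rewrite /mu -mprodXnE; apply: eq_bigr => i _; rewrite mxE.
apply/negP => /eqP /(congr1 (mcoeff (mu 1%g))).
rewrite mcoeff0 /determinant raddf_sum (bigD1 (1%g : {perm 'I_k})) //= prodE odd_perm1 mul1r.
rewrite mcoeffX eqxx big1 ?addr0; first by move/eqP; rewrite oner_eq0.
move=> s s1; rewrite prodE -signr_odd mulr_sign oddb.
suff muN : mu s != mu 1%g.
  by case: (odd_perm s); rewrite ?mcoeffN mcoeffX (negPf muN) ?oppr0.
apply: contra s1 => /eqP mus; apply/eqP/permP => j; rewrite perm1.
by apply: e_inj; rewrite -[LHS](muE 1%g) -mus perm1 muE.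
Qed.

(** * Relations between the Moore minors, and the first identity *)

(* The Moore matrix with its last row moved on top: the alternating Moore
   minors of the theorem are the cofactors of the first row of this matrix. *)
Definition rotMoore (A : comNzRingType) (q N : nat) (a : 'rV[A]_N.+1) :
    'M[A]_N.+1 :=
  \matrix_(i, j) a 0 j ^+ (q ^ (if nat_of_ord i is i'.+1 then i' else N)).

Definition Moore_minor (A : comNzRingType) (q N : nat) (a : 'rV[A]_N.+1)
    (j : 'I_N.+1) : A := (-1) ^+ j * Moore q (col' j a).

Lemma cofactor_rotMoore (A : comNzRingType) (q N : nat) (a : 'rV[A]_N.+1) j :
  cofactor (rotMoore q a) ord0 j = Moore_minor q a j.
Proof.
rewrite /cofactor add0n; congr (_ * \det _).
by apply/matrixP=> i l; rewrite !mxE.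
Qed.

(** Cofactors of row 0 of [rotMoore] are orthogonal to its row [l.+1], which holds the exponent
    $q^l$. *)
Lemma sum_Moore_minorM (A : comNzRingType) (q N : nat) (a : 'rV[A]_N.+1) l :
  (l < N)%N -> \sum_i Moore_minor q a i * a 0 i ^+ (q ^ l) = 0.
Proof.
move=> lN; have lN1 : (l.+1 < N.+1)%N by [].
have /matrixP /(_ (Ordinal lN1) ord0) := mul_mx_adj (rotMoore q a).
rewrite !mxE /= mulr0n => h; rewrite -[RHS]h; apply: eq_bigr => i _.
by rewrite !mxE cofactor_rotMoore mulrC.
Qed.

Lemma sum_Moore_minorM_last (A : comNzRingType) (q N : nat) (a : 'rV[A]_N.+1) :
  \sum_i Moore_minor q a i * a 0 i ^+ (q ^ N) = \det (rotMoore q a).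
Proof.
rewrite (expand_det_row _ ord0); apply: eq_bigr => i _.
by rewrite !mxE cofactor_rotMoore mulrC.
Qed.

(** The $q$-th power shifts the exponents of a minor to $q,\dots,q^N$, which turns it into a
    cofactor of the first row of the ordinary Moore matrix. *)
Lemma sum_Moore_minorX (A : comNzRingType) (q N : nat) (a : 'rV[A]_N.+1) :
  [char A].-nat q ->
  \sum_i Moore_minor q a i ^+ q * a 0 i = Moore q a.
Proof.
move=> hq; rewrite /Moore (expand_det_row _ ord0); apply: eq_bigr => i _.
rewrite mxE expn0 expr1 mulrC /Moore_minor exprMn sign_expr_pchar //.
rewrite /Moore det_expr_pchar // /cofactor add0n.
congr (_ * (_ * \det _)); apply/matrixP=> j l; rewrite !mxE.
by rewrite -exprM -expnSr.
Qed.

Lemma Moore_minors_expr (A : comNzRingType) (q N k l : nat) (a : 'rV[A]_N.+1) :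
  [char A].-nat q ->
  \sum_i Moore_minor q a i ^+ (q ^ k) * a 0 i ^+ (q ^ (k + l)) =
  (\sum_i Moore_minor q a i * a 0 i ^+ (q ^ l)) ^+ (q ^ k).
Proof.
move=> hq; rewrite sum_expr_pchar ?pchar_natX //; apply: eq_bigr => i _.
by rewrite [RHS]exprMn -exprM -expnD addnC.
Qed.

Lemma Moore_of_minors (A : idomainType) (q n m : nat)
    (Y : 'rV[A]_n.+1) (X : 'rV[A]_m) :
  [char A].-nat q ->
  \det (rotMoore q (row_mx Y X : 'rV_(n + m).+1)) != 0 ->
  Moore q (\row_(i < n.+1) ((-1) ^+ i * Moore q (row_mx (col' i Y) X)))
  = Moore q X ^+ (q ^ n) * Moore q (row_mx Y X) ^+ (\sum_(k < n) q ^ k).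
Proof.
set Z : 'rV_(n + m).+1 := row_mx Y X => hq; set W := rotMoore q Z => W0.
pose C : 'M[A]_(n.+1, n.+1 + m) :=
  \matrix_(k, i) Moore_minor q Z i ^+ (q ^ k).
pose Wt : 'M[A]_(n.+1 + m) := W^T.
pose B : 'M[A]_(n.+1 + m) := col_mx C (row_mx 0 1%:M).
pose P := C *m Wt.
(* Column [l.+1] of [Wt] has exponent $q^l$; for $k \le l$ the entry is the $q^k$-th power of the
   vanishing sum with exponent $q^{l-k}$. *)
have PE (k : 'I_n.+1) (l : 'I_(n.+1 + m)) : (k < l)%N -> P k l = 0.
  case: l => [[|l] lN] //= kl.
  transitivity (\sum_i Moore_minor q Z i ^+ (q ^ k) * Z 0 i ^+ (q ^ (k + (l - k)))).
    by rewrite mxE; apply: eq_bigr => i _; rewrite !mxE /= subnKC.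
  rewrite Moore_minors_expr // sum_Moore_minorM ?expr0n ?expn_eq0 //.
    by case: (q) hq.
  by rewrite ltn_subLR // ; apply: leq_trans (leq_addl _ _).
have P00 : P ord0 (lshift m ord0) = \det W.
  rewrite -sum_Moore_minorM_last mxE; apply: eq_bigr => i _.
  by rewrite !mxE /= expn0 expr1.
have PSS (k : 'I_n) : P (lift ord0 k) (lshift m (lift ord0 k)) = Moore q Z ^+ (q ^ k).
  rewrite -sum_Moore_minorX // sum_expr_pchar ?pchar_natX // mxE.
  by apply: eq_bigr => i _; rewrite !mxE /= [RHS]exprMn -exprM -expnS.
have detB : \det B = Moore q (\row_(i < n.+1) ((-1) ^+ i * Moore q (row_mx (col' i Y) X))).
  rewrite /B -[C]hsubmxK -/(block_mx _ _ _ _) det_ublock det1 mulr1.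
  congr (\det _); apply/matrixP=> k i; rewrite !mxE /Moore_minor /=.
  by rewrite -col'Kl.
have detS : \det (B *m Wt) = \det W * Moore q Z ^+ (\sum_(k < n) q ^ k)
                              * Moore q X ^+ (q ^ n).
  have -> : B *m Wt = col_mx P (dsubmx Wt).
    rewrite /B mul_col_mx -/P; congr col_mx.
    by rewrite -{1}[Wt]vsubmxK mul_row_col mul0mx add0r mul1mx.
  rewrite -[P]hsubmxK -[dsubmx Wt]hsubmxK.
  have -> : rsubmx P = 0.
    apply/matrixP=> k l; rewrite [RHS]mxE mxE PE //=.
    exact: leq_trans (ltn_ord k) (leq_addr _ _).
  rewrite -/(block_mx _ _ _ _) det_lblock det_trig; last first.
    by apply/is_trig_mxP=> i j ij; rewrite mxE PE.
  rewrite big_ord_recl mxE P00 expr_sum; congr (_ * _ * _).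
    by apply: eq_bigr => k _; rewrite mxE PSS.
  (* Column [rshift n.+1 j] of [Wt] has exponent $q^{n+j}$, so the last block is the transposed
     Moore matrix of [X] with entries raised to $q^n$. *)
  rewrite /Moore det_expr_pchar ?pchar_natX // -det_tr; congr (\det _).
  apply/matrixP=> i j; transitivity (Z 0 (rshift n.+1 j) ^+ (q ^ (n + i))).
    by rewrite !mxE.
  by rewrite [Z 0 _]row_mxEr !mxE -exprM -expnD addnC.
apply: (mulIf W0); rewrite -{1}detB -(det_tr W) -det_mulmx detS det_tr.
by rewrite mulrC mulrA mulrAC mulrC mulrA.
Qed.

(** * Moore's product identity, with [f] as the structure map of an algebra over [F] *)

Lemma pchar_nat_card (F : finFieldType) (A : comNzRingType)
    (f : {rmorphism F -> A}) : [char A].-nat #|F|.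
Proof.
have [p p_pr pF] := finPcharP F.
by rewrite (card_pprimeChar pF) pnatX pnatE // (rmorph_pchar f pF).
Qed.

Lemma rmorph_expr_card (F : finFieldType) (A : comNzRingType)
    (f : {rmorphism F -> A}) (x : F) (k : nat) :
  f x ^+ (#|F| ^ k) = f x.
Proof.
elim: k => [|k IHk]; first by rewrite expn0 expr1.
by rewrite expnSr exprM IHk -rmorphXn /= expf_card.
Qed.

Lemma Moore_map (A B : comNzRingType) (f : {rmorphism A -> B}) (q k : nat)
    (a : 'rV[A]_k) : Moore q (map_mx f a) = f (Moore q a).
Proof.
rewrite /Moore -det_map_mx; congr (\det _).
by apply/matrixP=> i j; rewrite !mxE rmorphXn.
Qed.

(** Powers of $|F|$ fix the coefficients, so [c] satisfies every row of the Moore matrix; the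
    adjugate then forces the determinant to vanish. *)
Lemma Moore_lin_dep (F : finFieldType) (A : idomainType)
    (f : {rmorphism F -> A}) (k : nat) (a : 'rV[A]_k) (c : 'rV[F]_k) :
  c != 0 -> \sum_j f (c 0 j) * a 0 j = 0 -> Moore #|F| a = 0.
Proof.
move=> c0 ca; have hq := pchar_nat_card f.
pose M := \matrix_(i < k, j < k) a 0 j ^+ (#|F| ^ i).
have Mc : M *m map_mx f c^T = 0.
  apply/matrixP=> i j; rewrite [RHS]mxE.
  transitivity ((\sum_j f (c 0 j) * a 0 j) ^+ (#|F| ^ i)); last first.
    by rewrite ca expr0n expn_eq0 -leqn0 leqNgt (cardD1 0).
  rewrite mxE sum_expr_pchar ?pchar_natX //; apply: eq_bigr => l _.
  by rewrite !mxE ord1 exprMn rmorph_expr_card mulrC.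
apply/eqP; apply: contraNT c0 => M0.
apply/eqP/rowP => j; rewrite mxE; apply: (fmorph_inj f).
have := congr1 (mulmx (\adj M)) Mc; rewrite mulmx0 mulmxA mul_adj_mx mul_scalar_mx.
move/matrixP/(_ j 0); rewrite !mxE => /eqP; rewrite mulf_eq0 (negPf M0) /=.
by rewrite rmorph0 => /eqP.
Qed.

(* As a polynomial in y, the left-hand side has degree q ^ k, leading
   coefficient (-1) ^+ k * Moore a, and vanishes on the q ^ k distinct
   F-linear combinations of the entries of a. *)
Lemma Moore_cons_field (F : finFieldType) (K : fieldType)
    (f : {rmorphism F -> K}) (k : nat) (a : 'rV[K]_k) (y : K) :
  Moore #|F| a != 0 ->
  Moore #|F| (row_mx y%:M a : 'rV_(1 + k)) =
  (-1) ^+ k * Moore #|F| a *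
    \prod_(c : 'rV[F]_k) (y - \sum_j f (c 0 j) * a 0 j).
Proof.
move=> a0; set q := #|F|.
have q1 : (1 < q)%N by apply: finNzRing_gt1.
pose M x : 'M[K]_k.+1 :=
  \matrix_(i < 1 + k, j < 1 + k) (row_mx x%:M a : 'rV_(1 + k)) 0 j ^+ (q ^ i).
pose d i := cofactor (M 0) i ord0.
pose P := \sum_(i < k.+1) d i *: 'X^(q ^ i).
(* Deleting the column of [x] removes all dependence on it, so these cofactors are the coefficients
   of a single polynomial [P]. *)
have cofM x i : cofactor (M x) i ord0 = d i.
  rewrite /d /cofactor; congr (_ * \det _); apply/matrixP=> l j.
  rewrite !mxE; case: splitP => // o; rewrite ord1 => /esym /eqP.
  by rewrite /= /bump.
have PM x : P.[x] = Moore q (row_mx x%:M a : 'rV_(1 + k)).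
  rewrite /Moore (expand_det_col _ ord0) horner_sum; apply: eq_bigr => i _.
  rewrite hornerZ hornerXn -(cofM x) mulrC; congr (_ * _).
  by rewrite !mxE; case: splitP => // o _; rewrite ord1 mxE eqxx.
have dmax : d ord_max = (-1) ^+ k * Moore q a.
  rewrite /d /cofactor addn0; congr (_ * \det _); apply/matrixP=> i j.
  rewrite !mxE lift_max; case: splitP => [o|o]; first by rewrite ord1.
  by rewrite /= /bump => /eqP; rewrite eqSS => /eqP /val_inj ->.
have dmax0 : d ord_max != 0 by rewrite dmax mulf_neq0 ?signr_eq0.
have szmax : size (d ord_max *: 'X^(q ^ k)) = (q ^ k).+1.
  by rewrite size_scale // size_polyXn.
have szlt : (size (\sum_(i < k) d (widen_ord (leqnSn k) i) *: 'X^(q ^ i))%R <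
    size (d ord_max *: 'X^(q ^ k))%R)%N.
  rewrite szmax ltnS; apply: leq_trans (size_sum _ _ _) _.
  apply/bigmax_leqP => i _; apply: leq_trans (size_scale_leq _ _) _.
  by rewrite size_polyXn ltn_exp2l.
have szP : size P = (q ^ k).+1.
  by rewrite /P big_ord_recr /= addrC size_polyDl // szmax.
have lcP : lead_coef P = (-1) ^+ k * Moore q a.
  rewrite /P big_ord_recr /= lead_coefDr // lead_coefZ lead_coefXn mulr1.
  exact: dmax.
pose comb (c : 'rV[F]_k) := \sum_j f (c 0 j) * a 0 j.
have combB b c : comb (b - c) = comb b - comb c.
  rewrite /comb -sumrB; apply: eq_bigr => j _.
  by rewrite !mxE rmorphB mulrBl.
have comb_inj : injective comb.
  move=> b c bc; apply/eqP; rewrite -subr_eq0; apply: contraNT a0 => bc0.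
  by apply/eqP; apply: (Moore_lin_dep bc0 (f := f)); rewrite -/(comb _) combB bc subrr.
(* At $y =$ [comb c], the vector $(1, -c)$ is a nontrivial relation. *)
have Pcomb c : root P (comb c).
  rewrite rootE PM; apply/eqP.
  apply: (Moore_lin_dep (f := f) (c := row_mx 1%:M (- c) : 'rV_(1 + k))).
    apply/eqP => /rowP /(_ (lshift k 0)).
    by rewrite [RHS]mxE row_mxEl mxE eqxx => /eqP; rewrite oner_eq0.
  rewrite big_split_ord big_ord1 /= !row_mxEl !mxE !eqxx rmorph1 mul1r.
  rewrite -[RHS](subrr (comb c)); congr (_ + _).
  rewrite /comb -sumrN; apply: eq_bigr => j _.
  by rewrite !row_mxEr mxE rmorphN mulNr.
rewrite -PM -lcP (@all_roots_prod_XsubC _ P (map comb (enum 'rV[F]_k))); last first.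
- by rewrite uniq_rootsE map_inj_uniq ?enum_uniq.
- by apply/allP => _ /mapP[c _ ->].
- by rewrite size_map -cardE card_mx mul1n szP.
rewrite lead_coefZ lead_coef_prod_XsubC // ?mulr1.
rewrite hornerZ horner_prod big_map big_enum; congr (_ * _).
by apply: eq_bigr => c _; rewrite hornerXsubC.
Qed.

(** The field case applies in the fraction field, into which [A] embeds. *)
Lemma Moore_cons (F : finFieldType) (A : idomainType)
    (f : {rmorphism F -> A}) (k : nat) (a : 'rV[A]_k) (y : A) :
  Moore #|F| a != 0 ->
  Moore #|F| (row_mx y%:M a : 'rV_(1 + k)) =
  (-1) ^+ k * Moore #|F| a *
    \prod_(c : 'rV[F]_k) (y - \sum_j f (c 0 j) * a 0 j).
Proof.
move=> a0; apply/eqP; rewrite -tofrac_eq; apply/eqP.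
pose g : {rmorphism F -> {fraction A}} := (@FracField.tofrac A) \o f.
rewrite -Moore_map map_row_mx map_scalar_mx (Moore_cons_field g).
  rewrite Moore_map !rmorphM rmorphXn rmorphN1 rmorph_prod; congr (_ * _).
  apply: eq_bigr => c _; rewrite rmorphB rmorph_sum; congr (_ - _).
  by apply: eq_bigr => j _; rewrite mxE rmorphM.
by rewrite Moore_map tofrac_eq0.
Qed.

(** * Moore determinants of indeterminates: nonvanishing and divisibility *)

Lemma Moore_vars_neq0 (R : comNzRingType) (q N k : nat) (g : 'I_k -> 'I_N) :
  (1 < q)%N -> injective g ->
  Moore q (\row_j ('X_(g j) : {mpoly R[N]})) != 0.
Proof.
move=> q1 g_inj.
have e_inj : injective (fun i : 'I_k => q ^ i)%N.
  by move=> i j /(expn_injective q1) /val_inj.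
have := det_var_expr_neq0 R g_inj e_inj; congr (\det _ != 0).
by apply/matrixP=> i j; rewrite !mxE.
Qed.

(** This permits the cancellation of $\det W$ in [Moore_of_minors]. *)
Lemma rotMoore_vars_neq0 (R : comNzRingType) (q N : nat) :
  (1 < q)%N ->
  \det (rotMoore q (\row_(j < N.+1) ('X_j : {mpoly R[N.+1]}))) != 0.
Proof.
move=> q1.
have e_inj : injective (fun i : 'I_N.+1 =>
    q ^ (if nat_of_ord i is i'.+1 then i' else N))%N.
  move=> [[|i] iN] [[|j] jN] /(expn_injective q1) /= ij; apply: val_inj => //=.
  - by rewrite -ij ltnn in jN.
  - by rewrite ij ltnn in iN.
  - by rewrite ij.
have := det_var_expr_neq0 R (@inj_id 'I_N.+1) e_inj; congr (\det _ != 0).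
by apply/matrixP=> i j; rewrite !mxE.
Qed.

(** By induction on [k], [Moore_cons] splits off one leading indeterminate at a time, each
    contributing a polynomial factor. *)
Lemma Moore_vars_dvd (F : finFieldType) (N k m : nat) (t : 'I_(k + m) -> 'I_N) :
  injective t ->
  exists c : {mpoly F[N]},
    Moore #|F| (\row_j ('X_(t j) : {mpoly F[N]})) =
    c * Moore #|F| (\row_(j < m) ('X_(t (rshift k j)) : {mpoly F[N]})).
Proof.
have q1 : (1 < #|F|)%N by apply: finNzRing_gt1.
elim: k t => [|k IHk] t t_inj.
  exists 1; rewrite mul1r; congr Moore; apply/rowP=> j; rewrite !mxE.
  by congr 'X_(t _); apply: val_inj.
pose t' (j : 'I_(k + m)) := t (lift ord0 j).
have t'_inj : injective t' by move=> i j /t_inj /lift_inj.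
have [c cE] := IHk t' t'_inj.
have := Moore_cons (@mpolyC N F) ('X_(t ord0)) (Moore_vars_neq0 F q1 t'_inj).
set pr := \prod_c _ => E; exists ((-1) ^+ (k + m) * pr * c).
transitivity ((-1) ^+ (k + m) * pr *
    Moore #|F| (\row_j ('X_(t' j) : {mpoly F[N]}))).
  rewrite mulrAC -E; congr Moore; apply/rowP=> j; rewrite !mxE.
  case: splitP => o jo; rewrite mxE.
    by rewrite !ord1 eqxx; congr 'X_(t _); apply: val_inj; rewrite /= jo ord1.
  by congr 'X_(t _); apply: val_inj; rewrite /= jo.
rewrite cE mulrA; congr (_ * Moore _ _); apply/rowP=> j; rewrite !mxE.
by congr 'X_(t _); apply: val_inj.
Qed.

(** * Scaling, and the two identities for indeterminates *)

Lemma Moore_scale (A : comNzRingType) (q k : nat) (u : 'rV[A]_k) (d : A) :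
  [char A].-nat q ->
  Moore q (\row_i ((-1) ^+ i * (u 0 i * d))) =
  (-1) ^+ k./2 * d ^+ (\sum_(i < k) q ^ i) * Moore q u.
Proof.
move=> hq; pose M := \matrix_(i < k, j < k) u 0 j ^+ (q ^ i).
have -> : Moore q (\row_i ((-1) ^+ i * (u 0 i * d))) =
    \det (diag_mx (\row_i d ^+ (q ^ i)) *m M *m diag_mx (\row_i (-1) ^+ i)).
  congr (\det _); apply/matrixP=> i j; rewrite mul_mx_diag mul_diag_mx !mxE.
  by rewrite !exprMn sign_expr_pchar ?pchar_natX // mulrC [u 0 j ^+ _ * _]mulrC.
rewrite !det_mulmx !det_diag -/(Moore q u) expr_sum.
under eq_bigr do rewrite mxE; under [X in _ * X]eq_bigr do rewrite mxE.
rewrite mulrC mulrA; congr (_ * _ * _).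
(* The column signs multiply to $(-1)^{0+1+\cdots+(k-1)}$, and this exponent has the parity of
   $\lfloor k/2\rfloor$. *)
rewrite -expr_sum -[LHS]signr_odd -[RHS]signr_odd; congr (_ ^+ _); congr nat_of_bool.
elim: k {u M} => [|k IHk]; first by rewrite big_ord0.
by rewrite big_ord_recr /= oddD IHk uphalf_half oddD oddb addbC.
Qed.

Theorem theorem4p1 (p s q : nat) (F : finFieldType) (n m : nat)
    (hp : prime p) (hq : q = (p ^ s)%N) (hF : #|F| = q) (hn : (2 <= n)%N) :
  let Y := varY F n m in
  let X := varX F n m in
  let e := (\sum_(k < n.-1) q ^ k)%N in
  (Moore q (\row_(i < n) ((-1) ^+ i * Moore q (row_mx (col' i Y) X)))
     = Moore q X ^+ (q ^ n.-1) * Moore q (row_mx Y X) ^+ e)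
  /\
  (exists (u : 'rV[{mpoly F[n + m]}]_n) (v : {mpoly F[n + m]}),
     [/\ forall i : 'I_n,
           is_quotient (Moore q (row_mx (col' i Y) X)) (Moore q X) (u 0 i),
         is_quotient (Moore q (row_mx Y X)) (Moore q X) v
       & Moore q u = (-1) ^+ n./2 * v ^+ e]).
Proof.
move=> Y X e; rewrite {}/e; subst q; rewrite -hF {p s hp hF}; set q := #|F|.
case: n hn @Y @X => // n _ Y X /=.
have q1 : (1 < q)%N by apply: finNzRing_gt1.
have hq : [char {mpoly F[n.+1 + m]}].-nat q.
  exact: pchar_nat_card (@mpolyC _ F).
have YX : row_mx Y X = \row_j 'X_j.
  apply/rowP=> j; rewrite -[j]splitK.
  by case: (split j) => i; rewrite /= ?row_mxEl ?row_mxEr !mxE.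
have X0 : Moore q X != 0 by apply: Moore_vars_neq0 => //; apply: rshift_inj.
have id1 : Moore q (\row_i ((-1) ^+ i * Moore q (row_mx (col' i Y) X))) =
    Moore q X ^+ (q ^ n) * Moore q (row_mx Y X) ^+ (\sum_(k < n) q ^ k).
  by apply: Moore_of_minors; rewrite ?YX //; apply: rotMoore_vars_neq0.
split; first exact: id1.
have [v vE] : exists v, Moore q (row_mx Y X) = v * Moore q X.
  by rewrite YX; apply: Moore_vars_dvd (@inj_id _).
have /fin_all_exists [u uE] (i : 'I_n.+1) :
    exists c, Moore q (row_mx (col' i Y) X) = c * Moore q X.
  (* [t] skips the index of $Y_i$; it sends the last [m] positions to those of [X], as $i \le n$. *)
  pose t (j : 'I_(n + m)) : 'I_(n.+1 + m) := lift (lshift m i) j.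
  have t_inj : injective t by apply: lift_inj.
  have -> : row_mx (col' i Y) X = \row_j 'X_(t j).
    by rewrite -col'Kl YX; apply/rowP=> j; rewrite !mxE.
  have -> : X = \row_j 'X_(t (rshift n j)).
    apply/rowP=> j; rewrite !mxE; congr 'X_(_); apply: val_inj.
    by rewrite /= /bump (leq_trans (ltn_ord i : (i <= n)%N)) ?leq_addr.
  exact: Moore_vars_dvd.
exists (\row_i u i), v; split=> [i||]; [by rewrite mxE | by [] |].
have := id1; rewrite (_ : \row_i _ =
    \row_i ((-1) ^+ i * ((\row_i u i) 0 i * Moore q X))); last first.
  by apply/rowP=> i; rewrite !mxE uE.
(* Both sides now carry $\Delta_m(X)$ to the power $1+q+\cdots+q^n$, which cancels; the sign is its
   own inverse and moves to the right. *)
rewrite Moore_scale // vE exprMn mulrCA -exprD big_ord_recr /=.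
rewrite [(q ^ n + _)%N]addnC mulrAC => /(mulIf (expf_neq0 _ X0)) <-.
by rewrite mulrA -expr2 sqrr_sign mul1r.
Qed.
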